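(* Fix $\epsilon>0$. There are constants $0<c\le C<+\infty$, depending only on $\epsilon$, such that for every integer $N\ge2$ and all reals $a,b$ with $|a|+|b|\le N$ and $\min\{|a|,|b|\}\ge\epsilon N$, the spectral gap $\lambda$ of the Metropolis chain on $B_N=\{1,\dots,N\}^2$ associated with the function $f(x,y)=e^{ax+by}$ on $[0,1]^2$ satisfies $c\le\lambda\le C$.
   Context: Given a positive function $f$ on $[0,1]^2$ and an integer $N$, define on $B_N=\{1,\dots,N\}^2$ the function $F_N(k_1,k_2)=f\left(\frac{k_1-1/2}{N},\frac{k_2-1/2}{N}\right)$ and the probability measure $\pi=F_N/\sum_{B_N}F_N$. The associated Metropolis chain (with proposal the simple random walk on the grid with holding at the boundary) is the Markov kernel $M$ on $B_N$ given by $M(\mathbf k,\mathbf l)=\frac14\min\{1,F_N(\mathbf l)/F_N(\mathbf k)\}$ if $|k_1-l_1|+|k_2-l_2|=1$, $M(\mathbf k,\mathbf l)=0$ if $|k_1-l_1|+|k_2-l_2|>1$, and $M(\mathbf k,\mathbf k)=1-\sum_{\mathbf l\ne\mathbf k}M(\mathbf k,\mathbf l)$. It is reversible with respect to $\pi$. The spectral gap is $\lambda=1-\beta_1$, where $\beta_1$ is the second largest eigenvalue of $M$ acting on $L^2(B_N,\pi)$. *)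

(* Defs.v *)
From HB Require Import structures.
From mathcomp Require Import all_boot all_order all_algebra.
From mathcomp Require Import polyrcf lra.
From mathcomp Require Import boolp classical_sets reals.

Set Implicit Arguments.
Unset Strict Implicit.
Unset Printing Implicit Defensive.

Import Order.TTheory GRing.Theory Num.Theory.

Local Open Scope classical_set_scope.
Local Open Scope ring_scope.

Section Spectrum.
Context {R : realType} {V : vectType R}.
Implicit Types (A : 'End(V)) (s t : seq R).

(* The real eigenvalues of A in nonincreasing order, each repeated according
   to the dimension of its eigenspace. *)
Definition is_spectrum A s : Prop :=
  sorted >=%R s /\
  forall x : R, count_mem x s = (\dim (passmx.leigenspace A x))%N.

Definition spectrum A : seq R := xget [::] [set s | is_spectrum A s].

Lemma is_spectrum_unique A s t : is_spectrum A s -> is_spectrum A t -> s = t.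
Proof.
move=> [ss cs] [st ct]; apply: (sorted_eq _ _ ss st).
- by move=> x y z yx xz; apply: le_trans xz yx.
- by move=> x y /andP[yx xy]; apply/le_anti/andP.
- by rewrite /perm_eq; apply/allP => x _; rewrite /= cs ct.
Qed.

Lemma is_spectrum_exists A : exists s, is_spectrum A s.
Proof.
pose e := vbasis {:V}; have eb : basis_of {:V} e := vbasisP _.
pose M := passmx.mxof e e A.
pose d x := (\dim (passmx.leigenspace A x))%N.
pose r := rootsR (char_poly M).
have rP x : x \notin r -> d x = 0%N.
  move=> xr; apply/eqP; rewrite /d dimv_eq0 (passmx.leigenspaceE eb).
  rewrite passmx.vsof_eq0 //.
  apply: contraNT xr => Mx.
  have : root (char_poly M) x by rewrite -eigenvalue_root_char.
  have := roots_on_rootsR (monic_neq0 (char_poly_monic M)).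
  by move=> /(_ x); rewrite in_itv /= => <-.
have ru : uniq r by apply/sorted_uniq/sorted_roots => //; exact: lt_trans.
exists (sort >=%R (flatten [seq nseq (d x) x | x <- r])); split.
  by apply: sort_sorted => x y; exact: le_total.
move=> x; rewrite (permP (permEl (perm_sort _ _))) count_flatten -map_comp.
rewrite (eq_map (g := fun y => ((x == y) * d x)%N)); last first.
  by move=> y /=; rewrite count_nseq /= eq_sym; case: eqP => // ->.
rewrite sumnE big_map -big_distrl /=.
have -> : (\sum_(y <- r) (x == y) = (x \in r))%N.
  rewrite -(count_uniq_mem x ru) -sum1_count [RHS]big_mkcond /=.
  by apply: eq_bigr => y _; rewrite eq_sym; case: eqP.
by rewrite -/(d x); case: (boolP (x \in r)) => [|/rP ->]; rewrite ?mul1n ?muln0.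
Qed.

Lemma spectrumP A : is_spectrum A (spectrum A).
Proof. exact: xgetPex (is_spectrum_exists A). Qed.

End Spectrum.

Section Kernel.
Context {R : realType} {T : finType}.
Implicit Types (P : T -> T -> R) (phi : {ffun T -> R^o}) (pi : T -> R).

Definition reversible pi P : Prop :=
  forall k l, pi k * P k l = pi l * P l k.

Definition kernel_fun P phi : {ffun T -> R^o} :=
  [ffun k => \sum_l P k l * phi l].

(* All functions on the finite set T, which is the space L^2(T, pi) as soon
   as pi charges every point. *)
Definition kernel_op P : 'End({ffun T -> R^o}) := linfun (kernel_fun P).

Fact kernel_fun_is_linear P : linear (kernel_fun P).
Proof.
move=> a phi psi; apply/ffunP => k; rewrite !ffunE scaler_sumr -big_split /=.
apply: eq_bigr => l _; rewrite !ffunE mulrDr; congr (_ + _).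
by rewrite mulrCA.
Qed.

Lemma kernel_opE P phi k : kernel_op P phi k = \sum_l P k l * phi l.
Proof.
pose L := GRing.isLinear.Build _ _ _ _ (kernel_fun P) (@kernel_fun_is_linear P).
pose f : {linear {ffun T -> R^o} -> {ffun T -> R^o}} := HB.pack (kernel_fun P) L.
by rewrite -[kernel_op P]/(linfun f) lfunE ffunE.
Qed.

(* Eigenvalues are counted with multiplicity from the top. The kernels of
   interest are reversible, hence diagonalizable over R, so that the spectrum
   has #|T| terms and the default value of nth is not used when #|T| > 1. *)
Definition second_eigenvalue P : R := nth 0 (spectrum (kernel_op P)) 1.

Definition spectral_gap P : R := 1 - second_eigenvalue P.

End Kernel.

Section Metropolis.
Context {R : realType}.
Variables (N : nat) (f : R -> R -> R).

Definition box : finType := ('I_N * 'I_N)%type.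
Implicit Types k l : box.

(* 'I_N starts at 0, so k_j in {1, ..., N} is k.j + 1 below. *)
Definition weight k : R :=
  f ((k.1.+1%:R - 1 / 2) / N%:R) ((k.2.+1%:R - 1 / 2) / N%:R).

Definition metropolis_pi k : R := weight k / \sum_(l : box) weight l.

Definition grid_dist k l : nat :=
  (`|(k.1 : nat)%:Z - (l.1 : nat)%:Z| + `|(k.2 : nat)%:Z - (l.2 : nat)%:Z|)%N.

Definition metropolis_move k l : R :=
  if grid_dist k l == 1%N then 1 / 4 * Num.min 1 (weight l / weight k) else 0.

Definition metropolis k l : R :=
  if k == l then 1 - \sum_(l' | l' != k) metropolis_move k l'
  else metropolis_move k l.

Lemma metropolis_sum1 k : \sum_l metropolis k l = 1.
Proof.
rewrite (bigD1 k) //= {1}/metropolis eqxx.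
rewrite [X in _ + X](eq_bigr (metropolis_move k)) ?subrK // => l lk.
by rewrite /metropolis eq_sym (negbTE lk).
Qed.

Hypothesis f_gt0 : forall x y : R, 0 <= x <= 1 -> 0 <= y <= 1 -> 0 < f x y.

Let coord_itv (i : 'I_N) : 0 <= ((i.+1%:R - 1 / 2) / N%:R : R) <= 1.
Proof.
have N0 : (0 < N%:R :> R) by rewrite ltr0n; apply: leq_ltn_trans (ltn_ord i).
have i1 : i.+1%:R <= N%:R :> R by rewrite ler_nat.
have i0 : 1 <= i.+1%:R :> R by rewrite ler1n.
by rewrite ler_pdivrMr // mul1r divr_ge0 ?ltW //=; lra.
Qed.

Lemma weight_gt0 k : 0 < weight k.
Proof. by apply: f_gt0. Qed.

Lemma sum_weight_gt0 : (0 < N)%N -> 0 < \sum_(l : box) weight l.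
Proof.
move=> N0; rewrite (bigD1 (Ordinal N0, Ordinal N0)) //=.
by rewrite ltr_pwDl ?weight_gt0 // sumr_ge0 // => l _; rewrite ltW ?weight_gt0.
Qed.

Lemma metropolis_pi_gt0 k : 0 < metropolis_pi k.
Proof.
rewrite divr_gt0 ?weight_gt0 // sum_weight_gt0 //.
exact: leq_ltn_trans (ltn_ord k.1).
Qed.

Lemma metropolis_pi_sum1 : (0 < N)%N -> \sum_k metropolis_pi k = 1.
Proof. by move=> N0; rewrite -mulr_suml divff // gt_eqF ?sum_weight_gt0. Qed.

Lemma metropolis_reversible : reversible metropolis_pi metropolis.
Proof.
move=> k l; rewrite /metropolis; case: (eqVneq k l) => [-> //|kl].
rewrite /metropolis_move.
have -> : grid_dist l k = grid_dist k l.
  by rewrite /grid_dist distnC; congr (_ + _)%N; rewrite distnC.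
case: ifP => _; last by rewrite !mulr0.
rewrite /metropolis_pi (mulrAC (weight k)) (mulrAC (weight l)); congr (_ / _).
rewrite (mulrCA (weight k)) (mulrCA (weight l)); congr (_ * _).
have wk := weight_gt0 k; have wl := weight_gt0 l.
rewrite !minr_pMr ?(ltW wk) ?(ltW wl) // !mulr1.
by rewrite ![_ * (_ / _)]mulrC !divfK ?gt_eqF // minC.
Qed.

End Metropolis.

Arguments weight {R} N f k.
Arguments metropolis_pi {R} N f k.
Arguments metropolis_move {R} N f k l.
Arguments metropolis {R} N f k l.

(* Main.v *)
(* For [f = exp (a x + b y)] the acceptance ratios do not depend on the position,
   so [1 - M] is a sum of two one-dimensional operators with constant rates [p], [q]
   and reflection at the ends. If [(1 - M) u = lam u], the discrete gradient [g] of
   [u] in the first direction satisfies the same equation with absorbing ends;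
   weighting it by [t ^ i], [t = exp (a / 2N)], and looking at the maximum of
   [t ^ i |g|] gives [lam >= p + q - p / t - q t = (1 - exp (- |a| / 2N))^2 / 4]
   or [g = 0], and likewise in the second direction. Hence only constants are
   eigenfunctions for [lam] below [(1 - exp (- eps / 2))^2 / 4]. The upper bound is
   [lam <= 2], read off at the maximum of [|u|]. *)
Require Import Defs.
From mathcomp Require Import all_boot all_order all_algebra.
From mathcomp Require Import reals sequences exp.
From mathcomp Require Import ring lra zify.

Import Order.TTheory GRing.Theory Num.Theory.
Local Open Scope ring_scope.

(** * From the ordered list of eigenvalues to eigenvectors *)

Section Spectrum.
Context {R : realType} {T : finType}.
Implicit Types (P : T -> T -> R) (phi : {ffun T -> R^o}).

Lemma spectrum_eigenvector P (x : R) : x \in spectrum (kernel_op P) ->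
  exists2 phi, phi != 0 & kernel_op P phi = x *: phi.
Proof.
move=> xs; pose U := passmx.leigenspace (kernel_op P) x.
have U0 : U != 0%VS.
  apply/eqP => U0; move: xs; apply/negP/count_memPn.
  by have [_ ->] := spectrumP (kernel_op P); rewrite -/U U0 dimv0.
exists (vpick U); first by rewrite vpick0.
have := memv_pick U; rewrite {2}/U /passmx.leigenspace memv_ker.
by rewrite !lfunE /= opp_lfunE scale_lfunE id_lfunE subr_eq0 => /eqP.
Qed.

(** The condition [x <= 0] covers the default value 0 of [nth] on a spectrum with fewer than two
    terms. *)
Lemma second_eigenvalue_ge P (x : R) : x <= 0 ->
  (forall y phi, phi != 0 -> kernel_op P phi = y *: phi -> x <= y) ->
  x <= second_eigenvalue P.
Proof.
move=> x0 xle; rewrite /second_eigenvalue.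
have [s1|s1] := ltnP 1 (size (spectrum (kernel_op P))); last first.
  by rewrite nth_default.
by have [phi] := spectrum_eigenvector _ _ (mem_nth 0 s1); exact: xle.
Qed.

(** If the second eigenvalue exceeded [x], so would the first, and eigenvectors of both would be
    constant, hence proportional. The two eigenvalues would then coincide and have multiplicity at
    least 2, although their eigenspace lies in a line. *)
Lemma second_eigenvalue_le P (x : R) : 0 <= x ->
  (forall y phi, x < y -> kernel_op P phi = y *: phi ->
     forall k l, phi k = phi l) ->
  second_eigenvalue P <= x.
Proof.
move=> x0 xcst; rewrite /second_eigenvalue; set s := spectrum _.
have [s1|s1] := ltnP 1 (size s); last by rewrite nth_default.
rewrite leNgt; apply/negP => xs1.
have [sorted_s count_s] := spectrumP (kernel_op P).
rewrite -/s in sorted_s count_s.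
have s0 : (0 < size s)%N by apply: ltnW.
have xs0 : x < s`_0.
  apply: (lt_le_trans xs1).
  have tr : transitive (>=%R : rel R) by move=> ? ? ? ? /le_trans; apply.
  by apply: (sorted_leq_nth tr (fun y : R => lexx y) 0 sorted_s 0%N 1%N).
have [phi phi0 phiE] := spectrum_eigenvector _ _ (mem_nth 0 s0).
have [psi psi0 psiE] := spectrum_eigenvector _ _ (mem_nth 0 s1).
have phi_neq0 k : phi k != 0.
  apply: contra_neq phi0 => pk; apply/ffunP => l.
  by rewrite (xcst _ _ xs0 phiE l k) pk ffunE.
have spanP y chi : x < y -> kernel_op P chi = y *: chi -> chi \in <[phi]>%VS.
  move=> xy chiE; have [k _|T0] := pickP (@predT T); last first.
    suff -> : chi = 0 by exact: mem0v.
    by apply/ffunP => k; have := T0 k.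
  apply/vlineP; exists (chi k / phi k); apply/ffunP => l.
  rewrite ffunE (xcst _ _ xy chiE l k) (xcst _ _ xs0 phiE l k).
  by rewrite /GRing.scale /= divfK.
have s01 : s`_0 = s`_1.
  have /vlineP[z psiz] := spanP _ _ xs1 psiE.
  move: psiE; rewrite psiz linearZ /= phiE scalerA mulrC -scalerA => /eqP.
  rewrite -subr_eq0 -scalerBl scaler_eq0 -psiz (negbTE psi0) orbF subr_eq0.
  by move/eqP.
have : (1 < count_mem (s`_0)%R s)%N.
  by case: (s) s1 s01 => [|y [|z r]] //= _ ->; rewrite !eqxx.
rewrite count_s ltnNge => /negP; apply.
have /dimvS : (passmx.leigenspace (kernel_op P) s`_0 <= <[phi]>)%VS.
  apply/subvP => chi; rewrite memv_ker.
  rewrite !lfunE /= opp_lfunE scale_lfunE id_lfunE subr_eq0 => /eqP.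
  exact: spanP.
by rewrite dim_vline phi0.
Qed.

End Spectrum.

(** * Maximum principles for a difference operator on a square grid *)

Section MaximumPrinciple.
Context {R : realFieldType}.

(** At the maximum of [|g| * t ^ i], the equation for [g] bounds [(p + q + p' + q' - lam) * |g|] by
    [(p / t + q * t + p' + q') * |g|], and the parts in [p'], [q'] cancel. *)
Lemma gradient_eq0 (n : nat) (u : nat -> nat -> R) (p q p' q' t lam : R) :
  0 < t -> 0 <= p -> 0 <= q -> 0 <= p' -> 0 <= q' ->
  (forall i j, (n <= i)%N -> u i.+1 j = u i j) ->
  (forall i j, (n <= j)%N -> u i j.+1 = u i j) ->
  (forall i j, (i <= n)%N -> (j <= n)%N ->
    p * (u i j - u i.+1 j) + q * (u i j - u i.-1 j) +
    (p' * (u i j - u i j.+1) + q' * (u i j - u i j.-1)) = lam * u i j) ->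
  lam < p + q - p / t - q * t ->
  forall i j, (i <= n)%N -> (j <= n)%N -> u i.+1 j = u i j.
Proof.
move=> t0 p0 q0 p'0 q'0 ui uj lu lam_lt i j ni nj.
pose g i j := u i.+1 j - u i j.
pose F (x : 'I_n.+1 * 'I_n.+1) := `|g x.1 x.2| * t ^+ x.1.
case: (arg_maxP (P := predT) F (erefl : predT (ord0, ord0))).
move=> -[[I ltI] [J ltJ]] _.
rewrite /F /= => Fmax.
have gmax i' j' : (i' <= n)%N -> (j' <= n)%N ->
    `|g i' j'| * t ^+ i' <= `|g I J| * t ^+ I.
  move=> ni' nj'; have := Fmax (inord i', inord j') isT.
  by rewrite /= !inordK.
suff gIJ : g I J = 0.
  have := gmax i j ni nj; rewrite gIJ normr0 mul0r.
  by rewrite pmulr_lle0 ?exprn_gt0 // normr_le0 subr_eq0 => /eqP.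
(* At [I = n] the gradient vanishes by freezing: the upper end is absorbing. *)
have [nI|In] := leqP n I; first by rewrite /g ui ?subrr.
set G := g I J in gmax *.
have gp : `|g I.+1 J| <= `|G| / t.
  rewrite ler_pdivlMr // -(ler_pM2r (exprn_gt0 I t0)) -mulrA -exprS.
  by apply: gmax.
(* The lower neighbour is a difference of [u] rather than [g I.-1 J]: at [I = 0] it is 0, the
   absorbing end, whereas [g 0.-1 J] would be [g 0 J]. *)
have gm : `|u I J - u I.-1 J| <= `|G| * t.
  case: {ui uj lu ltI Fmax} I In G gmax gp => [|I] In G gmax gp.
    by rewrite subrr normr0 mulr_ge0 ?normr_ge0 ?(ltW t0).
  rewrite -(ler_pM2r (exprn_gt0 I t0)) -mulrA -exprS.
  by apply: gmax; lia.
have gj j' : (j' <= n)%N -> `|g I j'| <= `|G|.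
  by move=> nj'; rewrite -(ler_pM2r (exprn_gt0 I t0)) gmax // ltnW.
(* In the second direction the ends reflect: beyond them [g] repeats its boundary value. *)
have gu : `|g I J.+1| <= `|G|.
  have [nJ|Jn] := leqP n J; last exact: gj.
  by rewrite /g !uj.
have gd : `|g I J.-1| <= `|G| by apply: gj; lia.
(* Difference of the equations at [I + 1] and [I]. *)
have GE : (p + q + p' + q' - lam) * G =
    p * g I.+1 J + q * (u I J - u I.-1 J) + (p' * g I J.+1 + q' * g I J.-1).
  have := lu I.+1 J In ltJ; have := lu I J (ltnW In) ltJ.
  rewrite /G /g /= => e1 e2; lra.
apply/eqP; rewrite -normr_eq0 eq_le normr_ge0 andbT leNgt; apply/negP => G0.
have := ler_norm ((p + q + p' + q' - lam) * `|G|).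
rewrite normrM normr_id -normrM GE leNgt => /negP; apply.
apply: (@le_lt_trans _ _
  (p * (`|G| / t) + q * (`|G| * t) + (p' * `|G| + q' * `|G|))).
  do ![apply: (le_trans (ler_normD _ _)); apply: lerD];
  by rewrite normrM ger0_norm // ler_wpM2l.
have -> : p * (`|G| / t) + q * (`|G| * t) + (p' * `|G| + q' * `|G|) =
    (p / t + q * t + p' + q') * `|G| by ring.
rewrite ltr_pM2r //; lra.
Qed.

(** At the maximum of [|u|], each of the four terms is at most [1 / 4 * (2 * |u|)], so
    [lam * |u| <= 2 * |u|]. *)
Lemma eigenfunction_eq0 (n : nat) (u : nat -> nat -> R) (p q p' q' lam : R) :
  0 <= p <= 1 / 4 -> 0 <= q <= 1 / 4 -> 0 <= p' <= 1 / 4 -> 0 <= q' <= 1 / 4 ->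
  (forall i j, (n <= i)%N -> u i.+1 j = u i j) ->
  (forall i j, (n <= j)%N -> u i j.+1 = u i j) ->
  (forall i j, (i <= n)%N -> (j <= n)%N ->
    p * (u i j - u i.+1 j) + q * (u i j - u i.-1 j) +
    (p' * (u i j - u i j.+1) + q' * (u i j - u i j.-1)) = lam * u i j) ->
  2 < lam ->
  forall i j, (i <= n)%N -> (j <= n)%N -> u i j = 0.
Proof.
move=> p0 q0 p'0 q'0 ui uj lu lam2 i j ni nj.
pose F (x : 'I_n.+1 * 'I_n.+1) := `|u x.1 x.2|.
case: (arg_maxP (P := predT) F (erefl : predT (ord0, ord0))).
move=> -[[I ltI] [J ltJ]] _.
rewrite /F /= => Fmax.
have umax i' j' : (i' <= n)%N -> (j' <= n)%N -> `|u i' j'| <= `|u I J|.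
  move=> ni' nj'; have := Fmax (inord i', inord j') isT.
  by rewrite /= !inordK.
suff uIJ : u I J = 0.
  by have := umax i j ni nj; rewrite uIJ normr0 normr_le0 => /eqP.
have step (r x : R) : 0 <= r <= 1 / 4 -> `|x| <= `|u I J| ->
    `|r * (u I J - x)| <= `|u I J| / 2.
  move=> /andP[r0 r4] xu; rewrite normrM ger0_norm //.
  apply: (@le_trans _ _ (1 / 4 * (`|u I J| + `|x|))); last lra.
  by rewrite ler_pM // ler_normB.
have u1 : `|u I.+1 J| <= `|u I J|.
  by have [nI|In] := leqP n I; [rewrite ui | exact: umax].
have u2 : `|u I.-1 J| <= `|u I J| by apply: umax; lia.
have u3 : `|u I J.+1| <= `|u I J|.
  by have [nJ|Jn] := leqP n J; [rewrite uj | exact: umax].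
have u4 : `|u I J.-1| <= `|u I J| by apply: umax; lia.
apply/eqP; rewrite -normr_eq0 eq_le normr_ge0 andbT leNgt; apply/negP => U0.
have : lam * `|u I J| <= 2 * `|u I J|.
  apply: (le_trans (ler_norm _)); rewrite normrM normr_id -normrM -lu //.
  apply: (@le_trans _ _ ((`|u I J| / 2 + `|u I J| / 2) +
     (`|u I J| / 2 + `|u I J| / 2))); last lra.
  by do ![apply: (le_trans (ler_normD _ _)); apply: lerD]; apply: step.
by rewrite ler_pM2r // leNgt lam2.
Qed.

End MaximumPrinciple.

(** * The Metropolis operator of an exponential weight *)

Section ExponentialMetropolis.
Context {R : realType}.

(* Freezing the coordinates at their top value encodes the holding at the upper
   boundary; the truncation [0.-1 = 0] takes care of the lower one. *)
Definition freeze (n : nat) (phi : {ffun box n.+1 -> R^o}) (i j : nat) : R :=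
  phi (inord (minn i n), inord (minn j n)).

Lemma freezeE n (phi : {ffun box n.+1 -> R^o}) (k : box n.+1) :
  freeze n phi k.1 k.2 = phi k.
Proof.
by case: k => i j; rewrite /freeze !(minn_idPl (leq_ord _)) !inord_val.
Qed.

Lemma freeze_inord n (phi : {ffun box n.+1 -> R^o}) (i j : nat) :
  (i <= n)%N -> (j <= n)%N ->
  phi (inord i, inord j) = freeze n phi i j.
Proof. by move=> ni nj; rewrite -freezeE /= !inordK. Qed.

Lemma freeze_topl n (phi : {ffun box n.+1 -> R^o}) (i j : nat) : (n <= i)%N ->
  freeze n phi i.+1 j = freeze n phi i j.
Proof. by move=> ni; rewrite /freeze (minn_idPr ni) (minn_idPr (leqW ni)). Qed.

Lemma freeze_topr n (phi : {ffun box n.+1 -> R^o}) (i j : nat) : (n <= j)%N ->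
  freeze n phi i j.+1 = freeze n phi i j.
Proof. by move=> nj; rewrite /freeze (minn_idPr nj) (minn_idPr (leqW nj)). Qed.

(** Probability of a unit step across which the logarithm of the weight grows by [x]. *)
Definition move_rate (x : R) : R := 1 / 4 * Num.min 1 (expR x).

Lemma move_rate_itv (x : R) : 0 <= move_rate x <= 1 / 4.
Proof.
rewrite /move_rate mulr_ge0 ?le_min ?expR_ge0 ?ler01 ?andbT //=; last lra.
by rewrite ler_piMr ?ge_min ?lexx //; lra.
Qed.

(* [move_rate (- x) = exp (- x) * move_rate x], so the tilt [exp (x / 2)] gives
   both off-diagonal rates their geometric mean. *)
Lemma move_rate_gap (x : R) :
  move_rate x + move_rate (- x) - move_rate x / expR (x / 2)
    - move_rate (- x) * expR (x / 2) = 1 / 4 * (1 - expR (- (`|x| / 2))) ^+ 2.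
Proof.
have half (y : R) : expR y = expR (y / 2) * expR (y / 2).
  by rewrite -expRD; congr expR; lra.
have VM (y : R) : expR (y / 2) * expR (- (y / 2)) = 1 by rewrite expRxMexpNx_1.
have min0 (y : R) : 0 <= y -> Num.min 1 (expR y) = 1.
  by move=> y0; rewrite min_l // -[X in X <= _]expR0 ler_expR.
have minN (y : R) : y <= 0 -> Num.min 1 (expR y) = expR y.
  by move=> y0; rewrite min_r // -[X in _ <= X]expR0 ler_expR.
have := VM x; rewrite /move_rate -expRN.
case: (leP 0 x) => [x0|/ltW x0].
  rewrite ger0_norm // min0 // (minN (- x)) ?oppr_le0 // (half (- x)) mulNr.
  set t := expR (x / 2); set s := expR (- (x / 2)) => ts.
  have -> : 1 / 4 * (s * s) * t = 1 / 4 * s * (t * s) by ring.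
  by rewrite ts; ring.
rewrite ler0_norm // (min0 (- x)) ?oppr_ge0 // minN // (half x) mulNr opprK.
set t := expR (x / 2); set s := expR (- (x / 2)) => ts.
have -> : 1 / 4 * (t * t) * s = 1 / 4 * t * (t * s) by ring.
by rewrite ts; ring.
Qed.

(** In terms of differences the holding probability drops out, since it multiplies
    [phi k - phi k]. *)
Lemma metropolis_opE (N : nat) (f : R -> R -> R) (phi : {ffun box N -> R^o}) k :
  kernel_op (metropolis N f) phi k =
  phi k - \sum_l metropolis_move N f k l * (phi k - phi l).
Proof.
rewrite kernel_opE.
have -> : phi k = \sum_l metropolis N f k l * phi k.
  by rewrite -mulr_suml metropolis_sum1 mul1r.
rewrite -sumrB; apply: eq_bigr => l _; rewrite -mulr_suml metropolis_sum1 mul1r.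
rewrite /metropolis; case: eqP => [<-|_]; first by rewrite subrr mulr0 subr0.
by rewrite mulrBr opprB addrC subrK.
Qed.

Lemma weight_expR_ratio (N : nat) (a b : R) (k l : box N) :
  weight N (fun x y => expR (a * x + b * y)) l /
  weight N (fun x y => expR (a * x + b * y)) k =
  expR (a / N%:R * ((l.1 : nat)%:R - (k.1 : nat)%:R) +
        b / N%:R * ((l.2 : nat)%:R - (k.2 : nat)%:R)).
Proof.
rewrite /weight -expRN -expRD; congr expR.
by rewrite -!natr1; ring.
Qed.

(** The factor on the right discards points outside the box, where [inord] falls back to a
    default. *)
Lemma sum_delta_box (n i j : nat) (F : box n.+1 -> R) :
  \sum_(l : box n.+1) ((l.1 == i :> nat) && (l.2 == j :> nat))%:R * F l =
  ((i <= n)%N && (j <= n)%N)%:R * F (inord i, inord j).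
Proof.
case: (boolP ((i <= n)%N && (j <= n)%N)) => [/andP[ni nj]|nij]; last first.
  rewrite mul0r big1 // => -[[x ltx] [y lty]] _ /=.
  case: eqP => [xi|_]; last by rewrite mul0r.
  case: eqP => [yj|_]; last by rewrite mul0r.
  by move: nij; rewrite -xi -yj -ltnS ltx -ltnS lty.
rewrite (bigD1 (inord i, inord j)) //= !inordK // !eqxx big1 ?addr0 // => -[x y].
move=> xy /=; case: eqP => [xi|_]; last by rewrite mul0r.
case: eqP => [yj|_]; last by rewrite mul0r.
by case/eqP: xy; rewrite -xi -yj !inord_val.
Qed.

(** A neighbour missing at the boundary contributes nothing to the kernel sum and a zero difference
    of [u] on the right. *)
Lemma metropolis_expR_opE (n : nat) (a b : R) (phi : {ffun box n.+1 -> R^o})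
    (u := freeze n phi) (A := a / n.+1%:R) (B := b / n.+1%:R) (i j : nat) :
  (i <= n)%N -> (j <= n)%N ->
  kernel_op (metropolis n.+1 (fun x y => expR (a * x + b * y))) phi
    (inord i, inord j) =
  u i j - (move_rate A * (u i j - u i.+1 j) + move_rate (- A) * (u i j - u i.-1 j)
    + (move_rate B * (u i j - u i j.+1) + move_rate (- B) * (u i j - u i j.-1))).
Proof.
move=> ni nj; rewrite metropolis_opE.
have phiE := freeze_inord n phi.
rewrite phiE //; congr (_ - _).
pose k : box n.+1 := (inord i, inord j).
pose c (l : box n.+1) :=
  move_rate (A * ((l.1 : nat)%:R - i%:R) + B * ((l.2 : nat)%:R - j%:R)) *
  (u i j - phi l).
pose d x y (l : box n.+1) : R := ((l.1 == x :> nat) && (l.2 == y :> nat))%:R.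
have cE l :
  metropolis_move n.+1 (fun x y => expR (a * x + b * y)) k l * (u i j - phi l) =
   d i.+1 j l * c l + (0 < i)%:R * (d i.-1 j l * c l) +
   (d i j.+1 l * c l + (0 < j)%:R * (d i j.-1 l * c l)).
  rewrite /metropolis_move weight_expR_ratio /= !inordK // -/A -/B.
  transitivity ((grid_dist k l == 1)%N%:R * c l).
    by rewrite /c /move_rate; case: eqP => _; rewrite ?mul1r ?mul0r.
  (* As [0.-1 = 0], the lower indicator at [i = 0] would select [k] itself; the factors [0 < i] and
     [0 < j] prevent this. *)
  have -> : (grid_dist k l == 1)%N =
      ((l.1 == i.+1 :> nat) && (l.2 == j :> nat) +
       (0 < i) * ((l.1 == i.-1 :> nat) && (l.2 == j :> nat)) +
       ((l.1 == i :> nat) && (l.2 == j.+1 :> nat) +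
       (0 < j) * ((l.1 == i :> nat) && (l.2 == j.-1 :> nat))))%N :> nat.
    rewrite /grid_dist /k /= !inordK //.
    by case: l => -[x ltx] [y lty] /=; lia.
  by rewrite !natrD !natrM !mulrDl !mulrA.
rewrite (eq_bigr _ (fun l _ => cE l)) !big_split -!big_distrr /= !sum_delta_box.
rewrite ni nj !andbT.
have shift x : x.+1%:R - x%:R = 1 :> R by rewrite -natr1; ring.
have shiftm x : (0 < x)%N -> x.-1%:R - x%:R = -1 :> R.
  by case: x => // x _ /=; rewrite -natr1; ring.
congr (_ + _ + (_ + _)).
- case: (ltnP i n) => [In|nI]; rewrite ?mul0r ?mul1r.
    by rewrite /c /= phiE // !inordK // shift subrr mulr0 addr0 mulr1.
  by rewrite /u freeze_topl // subrr mulr0.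
- case: (posnP i) => [->|i0]; first by rewrite mul0r subrr mulr0.
  have In : (i.-1 <= n)%N by lia.
  rewrite In !mul1r /c /= phiE // !inordK // shiftm //.
  by rewrite subrr mulr0 addr0 mulrN1.
- case: (ltnP j n) => [Jn|nJ]; rewrite ?mul0r ?mul1r.
    by rewrite /c /= phiE // !inordK // shift subrr mulr0 add0r mulr1.
  by rewrite /u freeze_topr // subrr mulr0.
- case: (posnP j) => [->|j0]; first by rewrite mul0r subrr mulr0.
  have Jn : (j.-1 <= n)%N by lia.
  rewrite Jn !mul1r /c /= phiE // !inordK // shiftm //.
  by rewrite subrr mulr0 add0r mulrN1.
Qed.

End ExponentialMetropolis.

Theorem proposition3p1 (R : realType) (eps : R) (heps : 0 < eps) :
  exists c C : R,
    [/\ 0 < c, c <= C &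
      forall (N : nat) (a b : R),
        (2 <= N)%N ->
        `|a| + `|b| <= N%:R ->
        eps * N%:R <= Num.min `|a| `|b| ->
        c <= spectral_gap (metropolis N (fun x y : R => expR (a * x + b * y)))
          <= C].
Proof.
(* The constant [c] below is the right side of [move_rate_gap] at [|x| = eps]; that expression
   increases with [|x|], and [|a| / N] and [|b| / N] are at least [eps]. *)
set s := expR (- (eps / 2)).
have s1 : s < 1 by rewrite /s -[X in _ < X]expR0 ltr_expR; lra.
have s0 : 0 < s by apply: expR_gt0.
pose c := 1 / 4 * (1 - s) ^+ 2.
have c0 : 0 < c by rewrite mulr_gt0 ?exprn_gt0 ?subr_gt0 //; lra.
have c1 : c <= 1 by rewrite /c; nra.
exists c, 2; split => // [|[//|n] a b _ _ hmin]; first lra.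
set P := metropolis _ _.
have rate_gap (x : R) (y := x / n.+1%:R) : eps * n.+1%:R <= `|x| ->
    c <= move_rate y + move_rate (- y) - move_rate y / expR (y / 2)
       - move_rate (- y) * expR (y / 2).
  move=> ex; rewrite move_rate_gap.
  have ey : eps <= `|y| by rewrite normrM normfV normr_nat ler_pdivlMr ?ltr0n.
  have : expR (- (`|y| / 2)) <= s by rewrite ler_expR; lra.
  rewrite /c; set r := expR _ => rs; have r0 : 0 < r by apply: expR_gt0.
  by rewrite ler_pM2l ?lerXn2r ?nnegrE; lra.
have [ea eb] : eps * n.+1%:R <= `|a| /\ eps * n.+1%:R <= `|b|.
  by move: hmin; rewrite le_min => /andP.
pose A := a / n.+1%:R; pose B := b / n.+1%:R.
have eqn y phi : kernel_op P phi = y *: phi ->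
    forall i j, (i <= n)%N -> (j <= n)%N ->
    let u := freeze n phi in
    move_rate A * (u i j - u i.+1 j) + move_rate (- A) * (u i j - u i.-1 j)
    + (move_rate B * (u i j - u i j.+1) + move_rate (- B) * (u i j - u i j.-1))
    = (1 - y) * u i j.
  move=> phiE i j ni nj u.
  have := metropolis_expR_opE n a b phi i j ni nj.
  rewrite -/P phiE ffunE freeze_inord // -/A -/B -/u /GRing.scale /= => e; lra.
have rate0 x : 0 <= @move_rate R x by case/andP: (move_rate_itv x).
rewrite /spectral_gap; apply/andP; split.
  suff : second_eigenvalue P <= 1 - c by lra.
  apply: second_eigenvalue_le => [|y phi cy phiE k l]; first by lra.
  have Eq := eqn y phi phiE.
  have gi : forall i j, (i <= n)%N -> (j <= n)%N ->
      freeze n phi i.+1 j = freeze n phi i j.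
    apply: (gradient_eq0 n (freeze n phi) _ _ _ _
      (expR (A / 2)) (1 - y)) Eq _ => //.
    - exact: expR_gt0.
    - exact: freeze_topl.
    - exact: freeze_topr.
    - by apply: lt_le_trans (rate_gap a ea); lra.
  (* The same with the coordinates exchanged, so that [B] supplies the tilt. *)
  have gj : forall j i, (j <= n)%N -> (i <= n)%N ->
      freeze n phi i j.+1 = freeze n phi i j.
    apply: (gradient_eq0 n (fun j i => freeze n phi i j)
      (move_rate B) (move_rate (- B)) (move_rate A) (move_rate (- A))
      (expR (B / 2)) (1 - y)) => //.
    - exact: expR_gt0.
    - by move=> j i; exact: freeze_topr.
    - by move=> j i; exact: freeze_topl.
    - by move=> j i nj ni; rewrite addrC; exact: Eq.
    - by apply: lt_le_trans (rate_gap b eb); lra.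
  have g0 i j : (i <= n)%N -> (j <= n)%N ->
      freeze n phi i j = freeze n phi 0 0.
    move=> + nj; elim: i => [_|i IH ni]; last by rewrite gi ?IH // ltnW.
    by elim: j nj => // j IH nj; rewrite gj ?IH // ltnW.
  by rewrite -(freezeE n phi k) -(freezeE n phi l) !g0 // -ltnS.
(* An eigenvalue [y < -1] would give [1 - y > 2], which forces the eigenfunction to vanish. *)
suff : -1 <= second_eigenvalue P by lra.
apply: second_eigenvalue_ge => [|y phi phi0 phiE]; first lra.
rewrite leNgt; apply: contra phi0 => y1; apply/eqP/ffunP => k; rewrite ffunE -freezeE.
apply: (eigenfunction_eq0 n _ _ _ _ _ (1 - y) _ _ _ _
  (freeze_topl n phi) (freeze_topr n phi) (eqn y phi phiE));
  rewrite ?move_rate_itv ?leq_ord //; lra.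
Qed.
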